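(* Let $A_1,\ldots,A_m\in\mathbb{M}_d$. Then, for all integers $i,j\ge 0$, $$\left[\lambda_{1+i+j}^{\downarrow}\left(\left|\sum_{k=1}^m A_k\right|\right)\right]^2\le 2\,\lambda_{1+i}^{\downarrow}\left(\sum_{k=1}^m|A_k|_{\mathrm{qsym}}\right)\lambda_{1+j}^{\downarrow}\left(\sum_{k=1}^m|A_k|_{\mathrm{qsym}}\right).$$
   Context: $d,m\ge 1$ are integers, $\mathbb{M}_d$ is the space of complex $d\times d$ matrices and $\mathbb{M}_d^+$ its cone of positive semidefinite matrices. For $A\in\mathbb{M}_d$, $|A|=(A^*A)^{1/2}$, so $|A^*|=(AA^* )^{1/2}$. The quadratic symmetric modulus of $A$ is $$|A|_{\mathrm{qsym}}:=\sqrt{\frac{|A|^2+|A^*|^2}{2}}\in\mathbb{M}_d^+.$$ For $A\in\mathbb{M}_d^+$, $\lambda_1^{\downarrow}(A)\ge\cdots\ge\lambda_d^{\downarrow}(A)$ are the eigenvalues of $A$ in nonincreasing order, with multiplicity, and by convention $\lambda_j^{\downarrow}(A):=0$ for $j>d$. *)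

(* Defs.v *)
From HB Require Import structures.
From mathcomp Require Import all_boot all_order all_algebra.
From mathcomp Require Import reals.
From mathcomp Require Import complex.

Set Implicit Arguments.
Unset Strict Implicit.
Unset Printing Implicit Defensive.

Import Order.TTheory GRing.Theory Num.Theory.
Local Open Scope ring_scope.
Local Open Scope sesquilinear_scope.

Definition psdmx (C : numClosedFieldType) (d : nat) (A : 'M[C]_d) : Prop :=
  A \is hermsymmx /\ forall x : 'rV[C]_d, 0 <= (x *m A *m x ^t*) 0 0.

(* A = P^-1 D P with P unitary and D diagonal (A normal) gives
   A^{1/2} = P^-1 D^{1/2} P; only meaningful for positive semidefinite A. *)
Definition sqrtmx (C : numClosedFieldType) (d : nat) (A : 'M[C]_d) : 'M[C]_d :=
  invmx (spectralmx A) *m diag_mx (map_mx sqrtC (spectral_diag A))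
    *m spectralmx A.

Definition absmx (C : numClosedFieldType) (d : nat) (A : 'M[C]_d) : 'M[C]_d :=
  sqrtmx (A ^t* *m A).

Definition qsymmx (C : numClosedFieldType) (d : nat) (A : 'M[C]_d) : 'M[C]_d :=
  sqrtmx (2^-1 *: (absmx A ^+ 2 + absmx (A ^t*) ^+ 2)).

Definition eigenvals (C : numClosedFieldType) (d : nat) (A : 'M[C]_d) : seq C :=
  sval (closed_field_poly_normal (char_poly A)).

(* Indexed from 1, as lambda_1 >= ... >= lambda_d, and 0 beyond d.  The real
   parts lose nothing when A is Hermitian; the value at index 0 is junk. *)
Definition lambda_down (R : realType) (d : nat) (A : 'M[R[i]]_d) (j : nat) : R :=
  nth 0 (sort >=%R [seq complex.Re z | z <- eigenvals A]) j.-1.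

Lemma char_poly_eigenvals (C : numClosedFieldType) (d : nat) (A : 'M[C]_d) :
  char_poly A = \prod_(z <- eigenvals A) ('X - z%:P).
Proof.
rewrite /eigenvals; case: closed_field_poly_normal => r /= {1}->.
by rewrite (monicP (char_poly_monic A)) scale1r.
Qed.

Lemma size_eigenvals (C : numClosedFieldType) (d : nat) (A : 'M[C]_d) :
  size (eigenvals A) = d.
Proof.
apply: succn_inj; rewrite -(size_char_poly A) char_poly_eigenvals.
by rewrite size_prod_XsubC.
Qed.

Lemma psdmx_mulCt (C : numClosedFieldType) (d : nat) (A : 'M[C]_d) :
  psdmx (A ^t* *m A).
Proof.
split.
  apply/is_hermitianmxP.
  by rewrite expr0 scale1r trmx_mul map_mxM -!map_trmx trmxK map_mxCK.
move=> x; pose y := x *m A ^t*.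
have -> : x *m (A ^t* *m A) *m x ^t* = y *m y ^t*.
  rewrite /y trmx_mul map_mxM -!mulmxA; congr (_ *m (_ *m _)).
  by rewrite trmxCK.
by rewrite mxE sumr_ge0 // => k _; rewrite !mxE mul_conjC_ge0.
Qed.

Lemma psdmx_conj_diag (C : numClosedFieldType) (d : nat) (P : 'M[C]_d)
    (D : 'rV[C]_d) :
  (forall k, 0 <= D 0 k) -> psdmx (P ^t* *m diag_mx D *m P).
Proof.
move=> D0.
have -> : P ^t* *m diag_mx D *m P =
    (diag_mx (map_mx sqrtC D) *m P) ^t* *m (diag_mx (map_mx sqrtC D) *m P).
  rewrite trmx_mul map_mxM !mulmxA; congr (_ *m _).
  rewrite -mulmxA; congr (_ *m _).
  rewrite tr_diag_mx map_diag_mx mulmx_diag; congr diag_mx.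
  apply/rowP => k; rewrite !mxE.
  have /conj_Creal E : sqrtC (D 0 k) \is Num.real by rewrite ger0_real ?sqrtC_ge0.
  by rewrite [X in X * _]E -expr2 sqrtCK.
exact: psdmx_mulCt.
Qed.

Lemma psdmx_spectral (C : numClosedFieldType) (d : nat) (A : 'M[C]_d) :
  psdmx A -> forall k, 0 <= spectral_diag A 0 k.
Proof.
move=> [hA posA] k.
have /orthomx_spectralP AE := hermitian_normalmx hA.
have U := spectral_unitarymx A.
have := posA (row k (spectralmx A)).
have -> : row k (spectralmx A) *m A = spectral_diag A 0 k *: row k (spectralmx A).
  rewrite -row_mul [X in row k (_ *m X)]AE !mulmxA mulmxV ?spectral_unit //.
  by rewrite mul1mx row_mul row_diag_mx -scalemxAl -rowE.
rewrite -scalemxAl mxE.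
have -> : (row k (spectralmx A) *m (row k (spectralmx A)) ^t*) 0 0 = 1.
  have /unitarymxP/matrixP/(_ k k) := U.
  rewrite !mxE eqxx mulr1n => <-.
  by apply: eq_bigr => l _; rewrite !mxE.
by rewrite mulr1.
Qed.

Lemma sqrtmx_psd (C : numClosedFieldType) (d : nat) (A : 'M[C]_d) :
  psdmx A -> psdmx (sqrtmx A).
Proof.
move=> pA; rewrite /sqrtmx invmx_unitary ?spectral_unitarymx //.
apply: psdmx_conj_diag => k; rewrite mxE sqrtC_ge0; exact: psdmx_spectral.
Qed.

Lemma sqrtmxK (C : numClosedFieldType) (d : nat) (A : 'M[C]_d) :
  psdmx A -> sqrtmx A ^+ 2 = A.
Proof.
move=> [hA _]; have /orthomx_spectralP AE := hermitian_normalmx hA.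
rewrite [RHS]AE /sqrtmx expr2 -mulmxE !mulmxA; congr (_ *m _).
rewrite mulmxK ?spectral_unit // -mulmxA; congr (_ *m _).
rewrite mulmx_diag; congr diag_mx; apply/rowP => k.
by rewrite !mxE -expr2 sqrtCK.
Qed.

Lemma sqrtmx_uniq (C : numClosedFieldType) (d : nat) (A B : 'M[C]_d) :
  psdmx A -> psdmx B -> B ^+ 2 = A -> B = sqrtmx A.
Proof.
move=> pA pB BE; have pS := sqrtmx_psd pA; have SE := sqrtmxK pA.
set S := sqrtmx A in pS SE *.
pose P := spectralmx S; pose s := spectral_diag S.
have PU : P \in unitmx by exact: spectral_unit.
have s0 : forall k, 0 <= s 0 k := psdmx_spectral pS.
have PS : P *m S = diag_mx s *m P.
  have /orthomx_spectralP E := hermitian_normalmx pS.1.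
  by rewrite [X in _ *m X]E !mulmxA mulmxV ?spectral_unit // mul1mx.
suff PB : P *m B = diag_mx s *m P.
  by rewrite -[B]mul1mx -(mulVmx PU) -mulmxA PB -PS mulmxA mulVmx ?mul1mx.
have hB : B ^t* = B by have /is_hermitianmxP := pB.1; rewrite expr0 scale1r => <-.
have norm0 (x : 'rV[C]_d) : (x *m x ^t*) 0 0 = 0 -> x = 0.
  rewrite mxE => /eqP; rewrite psumr_eq0; last first.
    by move=> i _; rewrite !mxE mul_conjC_ge0.
  move=> /allP x0; apply/rowP => i; have := x0 i (mem_index_enum _).
  by rewrite !mxE mul_conjC_eq0 => /eqP.
apply/row_matrixP => k; rewrite !row_mul row_diag_mx -scalemxAl -rowE.
set v := row k P; set c := s 0 k.
have vBB : v *m B *m B = c ^+ 2 *: v.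
  rewrite -mulmxA mulmxE -expr2 BE -SE expr2 -mulmxE mulmxA.
  have vS : v *m S = c *: v.
    by rewrite /v -row_mul PS row_mul row_diag_mx -scalemxAl -rowE.
  by rewrite vS -scalemxAl vS scalerA -expr2.
have [c0|c0] := eqVneq c 0.
  rewrite c0 scale0r; apply: norm0.
  by rewrite trmx_mul map_mxM hB mulmxA vBB c0 expr2 mulr0 scale0r mul0mx mxE.
pose w := v *m B - c *: v.
have wB : w *m B = - c *: w.
  by rewrite /w mulmxBl vBB -scalemxAl scalerBr scalerA mulNr !scaleNr -expr2 opprK addrC.
suff w0 : w = 0 by apply/eqP; rewrite -subr_eq0 -/w w0.
have c_gt0 : 0 < c by rewrite lt_def c0 s0.
have := pB.2 w; rewrite wB -scalemxAl mxE mulNr oppr_ge0 pmulr_rle0 // => le0.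
apply: norm0; apply/eqP; rewrite eq_le le0 /= mxE sumr_ge0 // => i _.
by rewrite !mxE mul_conjC_ge0.
Qed.

(* Main.v *)
(** Put S = sum A_k and Q = sum |A_k|_qsym. For Hermitian H and positive
    semidefinite G, H^2 <= G^2 implies H <= G. Applied to the dilation
    [0, A; A^*, 0] and to sqrt 2 diag(|A|_qsym, |A|_qsym) this gives
    2 Re <x A, y> <= sqrt 2 (<x |A|_qsym, x> + <y |A|_qsym, y>), an inequality
    that can be summed over the A_k. With t x in place of x and t varying, it
    becomes |<x S, y>|^2 <= 2 <x Q, x> <y Q, y> when <x S, y> >= 0, and a
    dimension count as for Weyl's inequalities produces x and y whose three
    forms are controlled by the three eigenvalues. *)

Require Import Defs.
From mathcomp Require Import all_boot all_order all_algebra.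
From mathcomp Require Import reals.
From mathcomp Require Import complex.
From mathcomp Require Import ring.

Import Order.TTheory GRing.Theory Num.Theory.
Local Open Scope ring_scope.
Local Open Scope sesquilinear_scope.

(** * Order statistics *)

(** In the decreasing list only the [i] entries before position [i] can exceed the one there. *)
Lemma count_sort_gt {disp : Order.disp_t} {T : orderType disp} (x0 : T) (s : seq T) i :
  (count (fun x => nth x0 (sort >=%O s) i < x)%O s <= i)%N.
Proof.
have /permP <- : perm_eq (sort >=%O s) s by rewrite perm_sort.
have := sort_sorted ge_total s; set t := sort _ s => t_sorted.
rewrite -{2}(cat_take_drop i t) count_cat.
have -> : count (fun x => nth x0 t i < x)%O (drop i t) = 0%N.
  (* Past the end [nth] returns the arbitrary [x0], but then [drop i t] is empty and nothing is left
     to count. *)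
  have [ti|it] := leqP (size t) i; first by rewrite drop_oversize.
  rewrite (drop_nth x0 it) /= ltxx add0n; apply/eqP.
  rewrite -leqn0 leqNgt -has_count; apply/hasPn => x.
  have : sorted >=%O (drop i t) by rewrite drop_sorted.
  rewrite (drop_nth x0 it) /= => /(order_path_min ge_trans)/allP le_x /le_x.
  by rewrite /= leNgt.
rewrite addn0 (leq_trans (count_size _ _)) // size_take.
by case: ltnP.
Qed.

(** The first [i.+1] entries of the decreasing list all qualify. *)
Lemma count_sort_ge {disp : Order.disp_t} {T : orderType disp} (x0 : T) (s : seq T) i :
  (i < size s)%N -> (i < count (fun x => nth x0 (sort >=%O s) i <= x)%O s)%N.
Proof.
have /permP <- : perm_eq (sort >=%O s) s by rewrite perm_sort.
rewrite -(size_sort >=%O s).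
have := sort_sorted ge_total s; set t := sort _ s => t_sorted it.
rewrite -{2}(cat_take_drop i.+1 t) count_cat ltn_addr //.
have sz : size (take i.+1 t) = i.+1 by rewrite size_takel.
rewrite -{1}sz; suff /eqP -> :
    count (fun x => nth x0 t i <= x)%O (take i.+1 t) == size (take i.+1 t) by [].
rewrite -all_count; apply/(all_nthP x0) => k; rewrite sz => ki.
rewrite nth_take //.
by apply: (sorted_leq_nth ge_trans ge_refl x0 t_sorted); rewrite ?inE ?(leq_trans ki).
Qed.

(** * Quadratic forms in row coordinates *)

Lemma dotmx_adj {C : numClosedFieldType} {n p} (x : 'rV[C]_n) (A : 'M_(n, p)) y :
  dotmx (x *m A) y = dotmx x (y *m A ^t*).
Proof. by rewrite !dotmxE trmx_mul map_mxM trmxCK mulmxA. Qed.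

Lemma dotmx_sum {C : numClosedFieldType} {n} (x y : 'rV[C]_n) :
  dotmx x y = \sum_k x 0 k * (y 0 k)^*.
Proof. by rewrite dotmxE mxE; apply: eq_bigr => k _; rewrite !mxE. Qed.

Lemma dotmx_conj {C : numClosedFieldType} {n} (x y : 'rV[C]_n) :
  dotmx x y = (dotmx y x)^*.
Proof.
rewrite !dotmx_sum rmorph_sum; apply: eq_bigr => k _.
by rewrite rmorphM /= conjCK mulrC.
Qed.

Lemma dotmx_row_mx {C : numClosedFieldType} {n p} (x x' : 'rV[C]_n) (y y' : 'rV_p) :
  dotmx (row_mx x y) (row_mx x' y') = dotmx x x' + dotmx y y'.
Proof. by rewrite !dotmxE tr_row_mx map_col_mx mul_row_col mxE. Qed.

Lemma dotmx_unitary {C : numClosedFieldType} {n} (P : 'M[C]_n) (x y : 'rV_n) :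
  P \is unitarymx -> dotmx (x *m P) (y *m P) = dotmx x y.
Proof. by move=> PU; rewrite dotmx_adj mulmxtVK. Qed.

Lemma hermsymmx_adj {C : numClosedFieldType} {n} (A : 'M[C]_n) :
  A \is hermsymmx -> A ^t* = A.
Proof. by move=> /is_hermitianmxP; rewrite expr0 scale1r => <-. Qed.

Lemma spectral_eq {C : numClosedFieldType} {n} {A : 'M[C]_n} : A \is hermsymmx ->
  A = (spectralmx A) ^t* *m diag_mx (spectral_diag A) *m spectralmx A.
Proof.
move=> /hermitian_normalmx/orthomx_spectralP {1}->.
by rewrite invmx_unitary ?spectral_unitarymx.
Qed.

(** The rows of [spectralmx A] form an orthonormal eigenbasis, in which [x *m (spectralmx A) ^t*]
    lists the coordinates of [x]. *)
Lemma dotmx_spectral {C : numClosedFieldType} {n} (A : 'M[C]_n) (x : 'rV_n) :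
  A \is hermsymmx ->
  dotmx (x *m A) x =
    \sum_k spectral_diag A 0 k * `|(x *m (spectralmx A) ^t*) 0 k| ^+ 2.
Proof.
move=> hA; rewrite {1}(spectral_eq hA) !mulmxA dotmx_adj dotmx_sum.
apply: eq_bigr => k _; rewrite mul_mx_diag mxE normCK mulrA.
by rewrite [X in X * _]mulrC.
Qed.

Lemma dotmx_spectral1 {C : numClosedFieldType} {n} (A : 'M[C]_n) (x : 'rV_n) :
  dotmx x x = \sum_k `|(x *m (spectralmx A) ^t*) 0 k| ^+ 2.
Proof.
have U : (spectralmx A) ^t* \is unitarymx.
  by rewrite trmxC_unitary spectral_unitarymx.
by rewrite -(dotmx_unitary _ _ _ U) dotmx_sum; apply: eq_bigr => k _; rewrite normCK.
Qed.

Lemma dotmx_le_spectral {C : numClosedFieldType} {n} (A : 'M[C]_n) (x : 'rV_n) a :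
    A \is hermsymmx ->
    (forall k, (x *m (spectralmx A) ^t*) 0 k = 0 \/ spectral_diag A 0 k <= a) ->
  dotmx (x *m A) x <= a * dotmx x x.
Proof.
move=> hA le_a; rewrite dotmx_spectral // (dotmx_spectral1 A) mulr_sumr.
apply: ler_sum => k _; case: (le_a k) => [->|le_ka].
  by rewrite normr0 expr2 !mulr0.
by rewrite ler_wpM2r ?exprn_ge0.
Qed.

Lemma spectral_le_dotmx {C : numClosedFieldType} {n} (A : 'M[C]_n) (x : 'rV_n) a :
    A \is hermsymmx ->
    (forall k, (x *m (spectralmx A) ^t*) 0 k = 0 \/ a <= spectral_diag A 0 k) ->
  a * dotmx x x <= dotmx (x *m A) x.
Proof.
move=> hA ge_a; rewrite dotmx_spectral // (dotmx_spectral1 A) mulr_sumr.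
apply: ler_sum => k _; case: (ge_a k) => [->|le_ak].
  by rewrite normr0 expr2 !mulr0.
by rewrite ler_wpM2r ?exprn_ge0.
Qed.

(** * Positive semidefinite matrices and comparison through squares *)

Lemma psdmx_dotmx {C : numClosedFieldType} {n} {A : 'M[C]_n} (x : 'rV_n) :
  psdmx A -> 0 <= dotmx (x *m A) x.
Proof. by move=> [_ /(_ x)]; rewrite dotmxE. Qed.

Lemma adj_hermsymmx {C : numClosedFieldType} {n} (A : 'M[C]_n) :
  A ^t* = A -> A \is hermsymmx.
Proof. by move=> AE; apply/is_hermitianmxP; rewrite expr0 scale1r AE. Qed.

Lemma psdmx0 {C : numClosedFieldType} {n} : psdmx (0 : 'M[C]_n).
Proof.
split=> [|x]; last by rewrite mulmx0 mul0mx mxE.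
by apply: adj_hermsymmx; rewrite trmx0 map_mx0.
Qed.

Lemma psdmxD {C : numClosedFieldType} {n} (A B : 'M[C]_n) :
  psdmx A -> psdmx B -> psdmx (A + B).
Proof.
move=> [hA pA] [hB pB]; split=> [|x].
  by apply: adj_hermsymmx; rewrite linearD map_mxD !hermsymmx_adj.
by rewrite mulmxDr mulmxDl mxE addr_ge0.
Qed.

Lemma psdmxZ {C : numClosedFieldType} {n} (a : C) (A : 'M[C]_n) :
  0 <= a -> psdmx A -> psdmx (a *: A).
Proof.
move=> a0 [hA pA]; split=> [|x].
  apply: adj_hermsymmx; rewrite linearZ map_mxZ hermsymmx_adj //=.
  by rewrite conj_Creal ?ger0_real.
by rewrite -scalemxAr -scalemxAl mxE mulr_ge0.
Qed.

(* If v is an eigenvector of G - H with eigenvalue mu < 0, then vH = vG - mu v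
   is strictly longer than vG. *)
Lemma sqr_le_dotmx {C : numClosedFieldType} {n} (H G : 'M[C]_n) :
    H \is hermsymmx -> psdmx G ->
    (forall v : 'rV_n, dotmx (v *m H) (v *m H) <= dotmx (v *m G) (v *m G)) ->
  forall v : 'rV_n, dotmx (v *m H) v <= dotmx (v *m G) v.
Proof.
move=> hH pG le_sqr v; have hG := pG.1.
have hM : G - H \is hermsymmx.
  by apply: adj_hermsymmx; rewrite linearB map_mxB !hermsymmx_adj.
rewrite -subr_ge0 -linearBl /= -mulmxBr dotmx_spectral // sumr_ge0 // => k _.
rewrite mulr_ge0 ?exprn_ge0 //.
pose P := spectralmx (G - H); set mu := spectral_diag _ 0 k.
have mu_real : mu \is Num.real.
  by have /mxOverP := hermitian_spectral_diag_real hM; apply.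
rewrite real_leNgt ?real0 //; apply/negP => mu_lt0.
pose u := row k P.
have uu : dotmx u u = 1.
  by have /row_unitarymxP := spectral_unitarymx (G - H); move=> ->; rewrite eqxx.
have uM : u *m (G - H) = mu *: u.
  rewrite [X in _ *m X](spectral_eq hM) !mulmxA /u -/P -row_mul.
  have /unitarymxP -> := spectral_unitarymx (G - H).
  by rewrite -!row_mul mul1mx row_mul row_diag_mx -scalemxAl -rowE.
have uH : u *m H = u *m G - mu *: u by rewrite -uM mulmxBr opprB addrC subrK.
have := le_sqr u; apply/negP; rewrite -real_ltNge ?ger0_real ?dnorm_ge0 //.
set g := dotmx (u *m G) u.
have g0 : 0 <= g by exact: psdmx_dotmx.
(* The excess over |uG|^2 is -2 mu g + mu^2, positive because mu < 0 <= g. *)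
have -> : dotmx (u *m H) (u *m H) =
    dotmx (u *m G) (u *m G) + (- mu * (g + g) + mu * mu).
  rewrite uH linearBl /= !linearBr /= !linearZl_LR !linearZr_LR /= uu.
  rewrite [dotmx u _]dotmx_conj -/g (conj_Creal mu_real).
  rewrite (conj_Creal (x := g)) ?ger0_real //; ring.
rewrite ltrDl ltr_wpDl ?nmulr_rgt0 //.
by rewrite mulr_ge0 ?addr_ge0 // oppr_ge0 ltW.
Qed.

(** * The quadratic symmetric modulus as a bound on forms *)

Lemma psdmx_mean_absmx_sqr {C : numClosedFieldType} {n} (A : 'M[C]_n) :
  psdmx (2^-1 *: (absmx A ^+ 2 + absmx (A ^t*) ^+ 2)).
Proof.
apply: psdmxZ; first by rewrite invr_ge0 ler0n.
by apply: psdmxD; rewrite sqrtmxK; exact: psdmx_mulCt.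
Qed.

Lemma psdmx_qsymmx {C : numClosedFieldType} {n} (A : 'M[C]_n) : psdmx (qsymmx A).
Proof. exact/sqrtmx_psd/psdmx_mean_absmx_sqr. Qed.

(** Both sides are the quadratic form of A^* A + A A^* at [x]. *)
Lemma dotmx_qsymmx {C : numClosedFieldType} {n} (A : 'M[C]_n) (x : 'rV_n) :
  2 * dotmx (x *m qsymmx A) (x *m qsymmx A) =
    dotmx (x *m A) (x *m A) + dotmx (x *m A ^t*) (x *m A ^t*).
Proof.
rewrite dotmx_adj (hermsymmx_adj _ (psdmx_qsymmx A).1) -mulmxA dotmx_conj.
rewrite mulmxE -expr2 sqrtmxK; last exact: psdmx_mean_absmx_sqr.
rewrite !sqrtmxK; try exact: psdmx_mulCt.
rewrite trmxCK -scalemxAr linearZl_LR /= rmorphM /= fmorphV /= conjC_nat.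
rewrite mulVKf ?pnatr_eq0 // -dotmx_conj mulmxDr linearDr /= addrC.
by rewrite !(dotmx_adj x) !mulmxA trmxCK.
Qed.

(* The Hermitian dilation H = [0, A; A^*, 0] satisfies
   H^2 = diag(A A^*, A^* A) <= diag(G, G)^2 for G = sqrt 2 |A|_qsym. *)
Lemma dotmx_le_qsymmx {C : numClosedFieldType} {n} (A : 'M[C]_n) (x y : 'rV_n) :
  dotmx (x *m A) y + dotmx (y *m A ^t*) x <=
    sqrtC 2 * (dotmx (x *m qsymmx A) x + dotmx (y *m qsymmx A) y).
Proof.
pose H := block_mx 0 A (A ^t*) 0; pose G := sqrtC 2 *: block_mx (qsymmx A) 0 0 (qsymmx A).
have r0 : 0 <= sqrtC 2 :> C by rewrite sqrtC_ge0 ler0n.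
have GE (u v : 'rV_n) :
    row_mx u v *m G = sqrtC 2 *: row_mx (u *m qsymmx A) (v *m qsymmx A).
  by rewrite -scalemxAr mul_row_block !mulmx0 addr0 add0r.
have HE (u v : 'rV_n) : row_mx u v *m H = row_mx (v *m A ^t*) (u *m A).
  by rewrite mul_row_block !mulmx0 addr0 add0r.
have hH : H \is hermsymmx.
  by apply: adj_hermsymmx; rewrite tr_block_mx map_block_mx !trmx0 !map_mx0 trmxCK.
have hG : G \is hermsymmx.
  apply: adj_hermsymmx; rewrite linearZ /= map_mxZ tr_block_mx map_block_mx.
  rewrite !trmx0 !map_mx0 !(hermsymmx_adj _ (psdmx_qsymmx A).1).
  by rewrite /= conj_Creal // ger0_real.
have pG : psdmx G.
  split=> // v; rewrite -dotmxE -[v]hsubmxK GE linearZl_LR /= dotmx_row_mx.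
  by rewrite mulr_ge0 ?addr_ge0 //; apply/psdmx_dotmx/psdmx_qsymmx.
have := sqr_le_dotmx H G hH pG _ (row_mx x y).
rewrite HE GE linearZl_LR /= !dotmx_row_mx [X in X <= _]addrC; apply=> v.
(* For v = (p, q), [dotmx_qsymmx] turns |vG|^2 into |pA|^2 + |pA^*|^2 + |qA|^2 + |qA^*|^2, while
   |vH|^2 is only |pA|^2 + |qA^*|^2. *)
rewrite -[v]hsubmxK HE GE linearZl_LR linearZr_LR /= !dotmx_row_mx.
rewrite conj_Creal ?ger0_real // mulrA -expr2 sqrtCK mulrDr !dotmx_qsymmx.
by rewrite [X in X <= _]addrC lerD // ?lerDl ?lerDr dnorm_ge0.
Qed.

(** * Dimension count and optimization over the scaling *)

(** The columns form a matrix with [n] rows and rank below [n], so its left kernel is nonzero. *)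
Lemma exists_orthogonal {F : fieldType} {n} (s : seq 'cV[F]_n) :
  (size s < n)%N -> exists2 c : 'rV_n, c != 0 & forall v, v \in s -> c *m v = 0.
Proof.
move=> sn; pose M := \matrix_(i < n, k < size s) s`_k i 0.
have Mker : kermx M != 0.
  by rewrite kermx_eq0 -row_leq_rank -ltnNge (leq_ltn_trans (rank_leq_col _)).
exists (nz_row (kermx M)) => [|v /(nthP 0)[k ks <-]]; first by rewrite nz_row_eq0.
have /sub_kermxP := nz_row_sub (kermx M).
move=> /(congr1 (col (Ordinal ks))); rewrite linear0 colE -mulmxA -colE.
by have -> : col (Ordinal ks) M = s`_k by apply/colP=> i; rewrite !mxE.
Qed.

(** The discriminant criterion for r a t^2 - 2 s t + r b. Testing t >= 0 suffices, since the vertex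
    s / (r a) is positive. *)
Lemma discr_le {C : numFieldType} (r s a b : C) : 0 < r -> 0 < s -> 0 <= a -> 0 <= b ->
  (forall t, 0 <= t -> 2 * t * s <= r * (t ^+ 2 * a + b)) -> s ^+ 2 <= r ^+ 2 * a * b.
Proof.
move=> r0 s0 a0 b0 le_t; have [aE|a_neq0] := eqVneq a 0.
  (* When a = 0 the left side is unbounded in t: this t makes it 2 r (b + 1), which exceeds r b. *)
  have t0 : 0 <= r * (b + 1) / s.
    by rewrite divr_ge0 ?(ltW s0) // mulr_ge0 ?(ltW r0) // addr_ge0.
  have := le_t _ t0; rewrite aE mulr0 add0r mulrA divfK ?gt_eqF //.
  rewrite mulrCA ler_pM2l // => le_b.
  have : b < 2 * (b + 1) by rewrite mulr_natl mulr2n -addrA ltrDl ltr_wpDr ?addr_ge0.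
  by move=> /lt_le_trans/(_ le_b); rewrite ltxx.
have a_gt0 : 0 < a by rewrite lt_def a_neq0.
have ra_gt0 : 0 < r * a by rewrite mulr_gt0.
have := le_t (s / (r * a)) (divr_ge0 (ltW s0) (ltW ra_gt0)).
rewrite -subr_ge0 => le0; rewrite -subr_ge0.
have -> : r ^+ 2 * a * b - s ^+ 2 =
  (r * a) * (r * ((s / (r * a)) ^+ 2 * a + b) - 2 * (s / (r * a)) * s).
  by field; rewrite a_neq0 gt_eqF.
by rewrite mulr_ge0 // ltW.
Qed.

Lemma dotmx_le_sum_qsymmx {C : numClosedFieldType} {n m} (A : 'I_m -> 'M[C]_n)
    (x y : 'rV_n) :
  dotmx (x *m \sum_k A k) y + dotmx (y *m (\sum_k A k) ^t*) x <=
    sqrtC 2 * (dotmx (x *m \sum_k qsymmx (A k)) x +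
               dotmx (y *m \sum_k qsymmx (A k)) y).
Proof.
elim/big_ind2: _ => [|T P T' P' leTP leTP'|k _].
- by rewrite trmx0 map_mx0 !mulmx0 !linear0l !addr0 mulr0.
- rewrite [(_ + _)^T]linearD map_mxD !mulmxDr !linearDl /= addrACA [X in _ * X]addrACA mulrDr.
  exact: lerD.
exact: dotmx_le_qsymmx.
Qed.

Lemma psdmx_sum_qsymmx {C : numClosedFieldType} {n m} (A : 'I_m -> 'M[C]_n) :
  psdmx (\sum_k qsymmx (A k)).
Proof. by elim/big_ind: _ => *; [exact: psdmx0|exact: psdmxD|exact: psdmx_qsymmx]. Qed.

(* Dimension count: some z <> 0 in the span of the eigenvectors of H = |S|
   indexed by I is such that x = z S^* is orthogonal to the eigenvectors of Q
   indexed by J, and y = z H to those indexed by K. As |x| = |y| and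
   <x S, y> = <y H, y> >= s |y|^2, the form inequality at t x and y gives
   2 t s <= r (t^2 a + b) for all t >= 0. *)
Lemma spectral_dominated_le {C : numClosedFieldType} {n} {S H Q : 'M[C]_n}
    {r s a b : C} {I J K : {set 'I_n}} :
    psdmx H -> H *m H = S ^t* *m S -> psdmx Q -> 0 < r ->
    (forall x y : 'rV_n, dotmx (x *m S) y + dotmx (y *m S ^t*) x <=
       r * (dotmx (x *m Q) x + dotmx (y *m Q) y)) ->
    0 < s -> 0 <= a -> 0 <= b -> (#|J| + #|K| < #|I|)%N ->
    (forall k, k \in I -> s <= spectral_diag H 0 k) ->
    (forall k, k \notin J -> spectral_diag Q 0 k <= a) ->
    (forall k, k \notin K -> spectral_diag Q 0 k <= b) ->
  s ^+ 2 <= r ^+ 2 * a * b.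
Proof.
move=> pH HS pQ r_gt0 le_form s_gt0 a_ge0 b_ge0 cardIJK geI leJ leK.
pose P := spectralmx H; pose U := spectralmx Q.
(* [c] holds the coordinates of z in the eigenbasis of H. The three lists encode that c vanishes off
   I, that x has no component along J, and that y has none along K. *)
have [|c c_neq0 c_ortho] := exists_orthogonal
  ([seq col k 1%:M | k <- enum (~: I)]
   ++ [seq col k (P *m S ^t* *m U ^t*) | k <- enum J]
   ++ [seq col k (P *m H *m U ^t*) | k <- enum K] : seq 'cV[C]_n).
  rewrite !size_cat !size_map -!cardE -[ltnRHS](card_ord n) -(cardsC I) addnC.
  by rewrite ltn_add2r.
have ortho_col (M : 'M_n) k : c *m col k M = 0 -> (c *m M) 0 k = 0.
  by move=> /matrixP/(_ 0 0); rewrite colE mulmxA -colE !mxE.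
have cI k : k \notin I -> c 0 k = 0.
  move=> kI; rewrite -[c]mulmx1; apply/ortho_col/c_ortho.
  by rewrite !mem_cat (map_f (fun k => col k _)) // mem_enum inE.
pose z := c *m P; pose x := z *m S ^t*; pose y := z *m H.
have xJ k : (x *m U ^t*) 0 k = 0 \/ spectral_diag Q 0 k <= a.
  have [kJ|/leJ] := boolP (k \in J); [left|by right].
  rewrite /x /z -!mulmxA (mulmxA P); apply/ortho_col/c_ortho.
  by rewrite !mem_cat (map_f (fun k => col k _)) ?orbT // mem_enum.
have yK k : (y *m U ^t*) 0 k = 0 \/ spectral_diag Q 0 k <= b.
  have [kK|/leK] := boolP (k \in K); [left|by right].
  rewrite /y /z -!mulmxA (mulmxA P); apply/ortho_col/c_ortho.
  by rewrite !mem_cat (map_f (fun k => col k _)) ?orbT // mem_enum.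
have yP k : (y *m P ^t*) 0 k = c 0 k * spectral_diag H 0 k.
  rewrite /y /z {1}(spectral_eq pH.1) -/P !mulmxA !mulmxtVK ?spectral_unitarymx //.
  by rewrite mul_mx_diag mxE.
have ge_s k : (y *m P ^t*) 0 k = 0 \/ s <= spectral_diag H 0 k.
  by have [/geI|/cI c0] := boolP (k \in I); [right|left; rewrite yP c0 mul0r].
have HH : H ^t* = H := hermsymmx_adj _ pH.1.
have xx : dotmx x x = dotmx y y.
  by rewrite /x /y !(dotmx_adj z) -!mulmxA HH HS trmxCK !mulmxA.
(* The coordinates of y are those of c times eigenvalues that are at least s > 0 on I, so y = 0
   would force c = 0. *)
have y_gt0 : 0 < dotmx y y.
  rewrite dnorm_gt0; apply: contraNneq c_neq0 => y0; apply/eqP/rowP => k.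
  have [kI|/cI -> //] := boolP (k \in I); last by rewrite mxE.
  have := yP k; rewrite y0 mul0mx mxE => /esym/eqP.
  by rewrite mulf_eq0 (gt_eqF (lt_le_trans s_gt0 (geI _ kI))) orbF => /eqP.
have xSy : dotmx (x *m S) y = dotmx (y *m H) y.
  by rewrite /x /y -!mulmxA HS.
have ySx : dotmx (y *m S ^t*) x = dotmx (y *m H) y.
  by rewrite dotmx_adj trmxCK dotmx_conj xSy conj_Creal // ger0_real ?psdmx_dotmx.
have le1 := spectral_le_dotmx H y s pH.1 ge_s.
have lea := dotmx_le_spectral Q x a pQ.1 xJ.
have leb := dotmx_le_spectral Q y b pQ.1 yK.
(* Since |x| = |y|, all three bounds are multiples of |y|^2 > 0, which cancels. *)
apply: discr_le => // t t_ge0; rewrite -(ler_pM2r y_gt0).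
have := le_form (t *: x) y.
rewrite -!scalemxAl !linearZl_LR !linearZr_LR /= xSy ySx.
rewrite !(conj_Creal (x := t)) ?ger0_real // => le_t.
apply: le_trans (le_trans le_t _).
  rewrite -mulrDl -mulr2n -[t *+ 2]mulr_natl -[leLHS]mulrA.
  by rewrite ler_wpM2l ?mulr_ge0 ?ler0n.
rewrite -mulrA ler_pM2l // mulrDl lerD // mulrA -expr2 -[leRHS]mulrA.
by rewrite ler_wpM2l ?exprn_ge0 // -xx.
Qed.

(** * Eigenvalues in decreasing order *)

Lemma char_poly_similar {F : comUnitRingType} {n} (P A : 'M[F]_n) :
  P \in unitmx -> char_poly (invmx P *m A *m P) = char_poly A.
Proof.
move=> PU; pose Q := map_mx polyC P; pose Q' := map_mx polyC (invmx P).
have Q'Q : Q' *m Q = 1%:M by rewrite -map_mxM mulVmx // map_mx1.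
rewrite /char_poly; have -> : char_poly_mx (invmx P *m A *m P) = Q' *m char_poly_mx A *m Q.
  rewrite /char_poly_mx mulmxBr mulmxBl !map_mxM; congr (_ - _).
  by rewrite scalar_mxC -mulmxA Q'Q mulmx1.
by rewrite !det_mulmx mulrAC -det_mulmx Q'Q det1 mul1r.
Qed.

(** Links the roots of the characteristic polynomial, which define [lambda_down], to the diagonal of
    the spectral decomposition. *)
Lemma perm_eigenvals {C : numClosedFieldType} {n} (A : 'M[C]_n) :
  A \is normalmx -> perm_eq (eigenvals A) [seq spectral_diag A 0 k | k : 'I_n].
Proof.
move=> /orthomx_spectralP AE; apply: prod_XsubC_eq.
rewrite -char_poly_eigenvals {1}AE char_poly_similar ?spectral_unit //.
rewrite char_poly_trig ?diag_mx_is_trig // big_image /=.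
by apply: eq_bigr => k _; rewrite mxE eqxx mulr1n.
Qed.

(** Supplies the exceptional sets J and K of the dimension count; [lambda_down] at 1 + i reads
    position i of the sorted list. *)
Lemma card_lambda_down_lt {R : realType} {n} (A : 'M[R[i]]_n) i : psdmx A ->
  (#|[set k | lambda_down A (1 + i) < complex.Re (spectral_diag A 0 k)]%R| <= i)%N.
Proof.
move=> pA; rewrite /lambda_down add1n /=.
have /(perm_map (@complex.Re R))/permP E := perm_eigenvals A (hermitian_normalmx pA.1).
apply: leq_trans (count_sort_gt 0 [seq complex.Re z | z <- eigenvals A] i).
rewrite E -map_comp count_map cardsE cardE.
by rewrite -size_filter enumT.
Qed.

Lemma card_lambda_down_ge {R : realType} {n} (A : 'M[R[i]]_n) i : psdmx A -> (i < n)%N ->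
  (i < #|[set k | lambda_down A (1 + i) <= complex.Re (spectral_diag A 0 k)]%R|)%N.
Proof.
move=> pA lt_in; rewrite /lambda_down add1n /=.
have /(perm_map (@complex.Re R))/permP E := perm_eigenvals A (hermitian_normalmx pA.1).
have := count_sort_ge 0 [seq complex.Re z | z <- eigenvals A] i.
rewrite size_map size_eigenvals => /(_ lt_in)/leq_trans; apply.
by rewrite E -map_comp count_map cardsE cardE -size_filter enumT.
Qed.

Lemma lambda_down_ge0 {R : realType} {n} (A : 'M[R[i]]_n) j : psdmx A -> 0 <= lambda_down A j.
Proof.
move=> pA; rewrite /lambda_down; set s := sort _ _.
have [/(nth_default 0) -> //|js] := leqP (size s) j.-1.
have := mem_nth 0 js; rewrite {2}/s mem_sort => /mapP[z + ->].
rewrite (perm_mem (perm_eigenvals A (hermitian_normalmx pA.1))) => /imageP[k _ ->].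
by have := psdmx_spectral pA k; rewrite lecE => /andP[].
Qed.

Theorem corollary2p6 (R : realType) (d m : nat) (hd : (1 <= d)%N) (hm : (1 <= m)%N)
    (A : 'I_m -> 'M[R[i]]_d) (i j : nat) :
  lambda_down (absmx (\sum_(k < m) A k)) (1 + i + j)%N ^+ 2
    <= 2 * lambda_down (\sum_(k < m) qsymmx (A k)) (1 + i)%N
         * lambda_down (\sum_(k < m) qsymmx (A k)) (1 + j)%N.
Proof.
set S := \sum_(k < m) A k; set Q := \sum_(k < m) qsymmx (A k).
have pQ : psdmx Q := psdmx_sum_qsymmx A.
have pH : psdmx (absmx S) by apply/sqrtmx_psd/psdmx_mulCt.
set a := lambda_down Q (1 + i); set b := lambda_down Q (1 + j).
have a_ge0 : 0 <= a by exact: lambda_down_ge0.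
have b_ge0 : 0 <= b by exact: lambda_down_ge0.
rewrite -addnA; set s := lambda_down (absmx S) _.
have s_ge0 : 0 <= s by exact: lambda_down_ge0.
have [s0|s_neq0] := eqVneq s 0; first by rewrite s0 expr2 mulr0 !mulr_ge0.
have s_gt0 : 0 < s by rewrite lt_def s_neq0.
(* Beyond d the value defaults to 0, so s > 0 puts the position i + j inside the list. *)
have ijd : (i + j < d)%N.
  rewrite ltnNge; apply: contra_neqN s_neq0 => le_d; apply: nth_default.
  by rewrite size_sort size_map size_eigenvals.
have Re_spectral (B : 'M[R[i]]_d) k : psdmx B ->
    spectral_diag B 0 k = (complex.Re (spectral_diag B 0 k))%:C%C.
  by move=> pB; rewrite RRe_real // ger0_real ?psdmx_spectral.
have HS : absmx S *m absmx S = S ^t* *m S.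
  by rewrite mulmxE -expr2 sqrtmxK //; exact: psdmx_mulCt.
have r_gt0 : 0 < sqrtC 2 :> R[i] by rewrite sqrtC_gt0 ltr0n.
(* |J| <= i, |K| <= j and i + j < |I|, where I collects the eigenvalues of |S| that are at least
   s. *)
have cardIJK := leq_ltn_trans
  (leq_add (card_lambda_down_lt Q i pQ) (card_lambda_down_lt Q j pQ))
  (card_lambda_down_ge (absmx S) (i + j) pH ijd).
have := spectral_dominated_le (s := s%:C%C) (a := a%:C%C) (b := b%:C%C)
  pH HS pQ r_gt0 (dotmx_le_sum_qsymmx A) _ _ _ cardIJK.
(* The factor 2 is the square of [sqrtC 2]; the complex inequality between real numbers then
   descends to [R]. *)
rewrite sqrtCK -(rmorph_nat (real_complex R)) -rmorphXn -!rmorphM /= !lecR ltcR.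
apply=> // k; rewrite inE -?leNgt Re_spectral // lecR //.
Qed.
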